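(* Let $(X,x_0)$ be a pointed topological space and $n\ge2$. Then $$\pi_n^{wh}(X,x_0)\preccurlyeq \pi_n^{\pi^s(X,x_0)}(X,x_0).$$ Also, $X$ is $n$-semilocally $\pi^s(X,x_0)$-connected at $x_0$ if and only if $\pi_n^{wh}(X,x_0)=\pi_n^{\pi^s(X,x_0)}(X,x_0)$ (equality of topologies). Moreover, if $\pi_n^{wh}(X,x_0)=\pi_n^{K}(X,x_0)$ for a subgroup $K$ of $\pi_n(X,x_0)$, then $K=\pi^s(X,x_0)$.
   Context: An $n$-loop at $x_0$ is a continuous map $\alpha:I^n\to X$ with $\alpha(\partial I^n)=\{x_0\}$; $\pi_n(X,x_0)$ is the group of homotopy classes rel $\partial I^n$ of $n$-loops at $x_0$. An $n$-loop $\alpha$ at $x_0$ is small if for every open neighbourhood $U$ of $x_0$ there is an $n$-loop $f$ at $x_0$ with $f(I^n)\subseteq U$ and $[\alpha]=[f]$. The $n$-small subgroup $\pi^s(X,x_0)\le\pi_n(X,x_0)$ consists of the homotopy classes of all small $n$-loops at $x_0$. For an open neighbourhood $U$ of $x_0$, $\pi_n(i)(\pi_n(U,x_0))$ is the image in $\pi_n(X,x_0)$ of the homomorphism induced by the inclusion $i:U\hookrightarrow X$. For a subgroup $H\le\pi_n(X,x_0)$, $X$ is $n$-semilocally $H$-connected at $x_0$ if there is an open neighbourhood $U$ of $x_0$ with $\pi_n(i)(\pi_n(U,x_0))\le H$. A neighbourhood family on a group $G$ is a (nonempty) collection $\Sigma$ of subgroups such that for all $H,K\in\Sigma$ there is $S\in\Sigma$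 with $S\subseteq H\cap K$; the subgroup topology determined by $\Sigma$ has as a basis all left cosets of elements of $\Sigma$. The whisker topology $\pi_n^{wh}(X,x_0)$ is the subgroup topology determined by $\Sigma^{wh}=\{\pi_n(i)(\pi_n(U,x_0))\mid U\text{ open in }X,\ x_0\in U\}$. For a subgroup $H\le\pi_n(X,x_0)$, $\pi_n^H(X,x_0)$ denotes $\pi_n(X,x_0)$ with the subgroup topology determined by $\Sigma^H=\{K\le\pi_n(X,x_0)\mid H\subseteq K\}$. $A\preccurlyeq B$ means that the topology $B$ is finer than $A$ (not necessarily strictly). *)

(* Defs.v *)
From HB Require Import structures.
From mathcomp Require Import all_boot all_order all_algebra.
From mathcomp Require Import all_classical all_reals.
From mathcomp Require Import topology normedtype.
From mathcomp Require Import lra.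

Set Implicit Arguments.
Unset Strict Implicit.
Unset Printing Implicit Defensive.
Import Order.TTheory GRing.Theory Num.Theory.
Import numFieldNormedType.Exports.
Local Open Scope classical_set_scope.
Local Open Scope ring_scope.
Local Open Scope quotient_scope.

Section Continuity.

Lemma within_comp (T U V : topologicalType) (A : set T) (B : set U)
    (f : T -> U) (g : U -> V) :
  {within A, continuous f} -> {within B, continuous g} ->
  (forall x, A x -> B (f x)) -> {within A, continuous (g \o f)}.
Proof.
move=> /subspace_continuousP cf /subspace_continuousP cg AB.
apply/subspace_continuousP => x Ax W /= /(cg _ (AB _ Ax)) /= gW.
have := cf _ Ax _ gW; rewrite !nbhs_simpl /= /within /=.
by apply: filterS => y /= h Ay; apply: h => //; exact: AB.
Qed.

Lemma within_pair (T U V : topologicalType) (A : set T)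
    (f : T -> U) (g : T -> V) :
  {within A, continuous f} -> {within A, continuous g} ->
  {within A, continuous (fun x => (f x, g x))}.
Proof. by move=> cf cg x; apply: cvg_pair; [exact: cf|exact: cg]. Qed.

Lemma within_mx (R : topologicalType) (T : topologicalType) m n (A : set T)
    (f : T -> 'M[R]_(m, n)) :
  (forall i j, {within A, continuous (fun x => f x i j)}) ->
  {within A, continuous f}.
Proof.
move=> cf x W [P fP PW]; rewrite nbhs_simpl /=.
suff : \forall y \near (x : subspace A), forall i j, P i j (f y i j).
  by apply: filterS => y ?; exact: PW.
have FF : Filter (nbhs (x : subspace A)) by exact: nbhs_filter.
apply: (filter_forall (F := nbhs (x : subspace A))) => i.
apply: (filter_forall (F := nbhs (x : subspace A))) => j.
exact: (cf i j x _ (fP i j)).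
Qed.

Lemma within_if (R : realType) (T U : topologicalType) (A : set T)
    (c : T -> R) (r : R) (f g : T -> U) :
  closed A -> continuous c ->
  {within A `&` [set x | c x <= r], continuous f} ->
  {within A `&` [set x | r <= c x], continuous g} ->
  (forall x, A x -> c x = r -> f x = g x) ->
  {within A, continuous (fun x => if c x <= r then f x else g x)}.
Proof.
move=> clA cc cf cg fg.
have -> : A = (A `&` [set x | c x <= r]) `|` (A `&` [set x | r <= c x]).
  rewrite -setIUr; apply/esym/setIidPl => x _ /=.
  by case/orP: (le_total (c x) r) => ?; [left|right].
apply: withinU_continuous.
- by apply: closedI => //; apply: (preimage_closed _ (@closed_le R r)) => x _; exact: cc.
- by apply: closedI => //; apply: (preimage_closed _ (@closed_ge R r)) => x _; exact: cc.
- apply: subspace_eq_continuous cf => x /set_mem [_ /= cx].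
  by rewrite /from_subspace cx.
- apply: subspace_eq_continuous cg => x /set_mem [Ax /= cx].
  rewrite /from_subspace; case: ifPn => // cx'; rewrite fg //.
  by apply/eqP; rewrite eq_le cx' cx.
Qed.

End Continuity.

Section RealContinuity.
Variables (R : realType) (T : topologicalType).
Implicit Types f g : T -> R.

Lemma cont_cst (r : R) : continuous (fun _ : T => r).
Proof. by move=> x; exact: cvg_cst. Qed.

Lemma cont_add f g : continuous f -> continuous g ->
  continuous (fun x => f x + g x).
Proof. by move=> cf cg x; apply: cvgD; [exact: cf|exact: cg]. Qed.

Lemma cont_sub f g : continuous f -> continuous g ->
  continuous (fun x => f x - g x).
Proof. by move=> cf cg x; apply: cvgB; [exact: cf|exact: cg]. Qed.

Lemma cont_mul f g : continuous f -> continuous g ->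
  continuous (fun x => f x * g x).
Proof. by move=> cf cg x; apply: cvgM; [exact: cf|exact: cg]. Qed.

Lemma cont_min f g : continuous f -> continuous g ->
  continuous (fun x => Num.min (f x) (g x)).
Proof. by move=> cf cg x; apply: (@continuous_min R); [exact: cf|exact: cg]. Qed.

Lemma cont_max f g : continuous f -> continuous g ->
  continuous (fun x => Num.max (f x) (g x)).
Proof. by move=> cf cg x; apply: (@continuous_max R); [exact: cf|exact: cg]. Qed.

End RealContinuity.

Lemma cont_pair (T U V : topologicalType) (f : T -> U) (g : T -> V) :
  continuous f -> continuous g -> continuous (fun x => (f x, g x)).
Proof. by move=> cf cg x; apply: cvg_pair; [exact: cf|exact: cg]. Qed.

Lemma cont_fst (T U : topologicalType) : continuous (@fst T U).
Proof. by move=> x; exact: cvg_fst. Qed.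

Lemma cont_snd (T U : topologicalType) : continuous (@snd T U).
Proof. by move=> x; exact: cvg_snd. Qed.

Lemma cont_id (T : topologicalType) : continuous (fun x : T => x).
Proof. by move=> x; exact: cvg_id. Qed.

Lemma cont_comp (T U V : topologicalType) (f : T -> U) (g : U -> V) :
  continuous f -> continuous g -> continuous (fun x => g (f x)).
Proof. by move=> cf cg x; apply: (continuous_comp (cf x)); exact: cg. Qed.

Section Cube.
Variable R : realType.

Definition unit_cube (n : nat) : set 'rV[R]_n :=
  [set x | forall i, 0 <= x ord0 i <= 1].

Definition cube_boundary (n : nat) : set 'rV[R]_n :=
  [set x | unit_cube x /\ exists i, x ord0 i = 0 \/ x ord0 i = 1].

Definition set_coord0 (n : nat) (x : 'rV[R]_n.+1) (t : R) : 'rV[R]_n.+1 :=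
  \row_j (if j == ord0 then t else x ord0 j).

Lemma set_coord00 n (x : 'rV_n.+1) t : set_coord0 x t ord0 ord0 = t.
Proof. by rewrite mxE eqxx. Qed.

Lemma set_coord0_id n (x : 'rV_n.+1) : set_coord0 x (x ord0 ord0) = x.
Proof. by apply/rowP => j; rewrite mxE; case: eqP => // ->. Qed.

Lemma set_coord0_set n (x : 'rV_n.+1) s t :
  set_coord0 (set_coord0 x s) t = set_coord0 x t.
Proof. by apply/rowP => j; rewrite !mxE; case: eqP. Qed.

Lemma cube_set_coord0 n (x : 'rV_n.+1) t :
  unit_cube x -> 0 <= t <= 1 -> unit_cube (set_coord0 x t).
Proof. by move=> cx ct i; rewrite mxE; case: ifP. Qed.

Lemma boundary_set_coord0 n (x : 'rV_n.+1) t :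
  unit_cube x -> t = 0 \/ t = 1 -> cube_boundary (set_coord0 x t).
Proof.
move=> cx t01; split; last by exists ord0; rewrite set_coord00.
by apply: cube_set_coord0 => //; case: t01 => ->; rewrite lexx ler01.
Qed.

Lemma boundary_coord0P n (x : 'rV_n.+1) : cube_boundary x ->
  (x ord0 ord0 = 0 \/ x ord0 ord0 = 1) \/
  (forall t, 0 <= t <= 1 -> cube_boundary (set_coord0 x t)).
Proof.
move=> [cx [i xi]]; case: (eqVneq i ord0) xi => [->|i0] xi; first by left.
right=> t ct; split; first exact: cube_set_coord0.
by exists i; rewrite mxE (negbTE i0).
Qed.

Lemma within_set_coord0 n (T : topologicalType) (A : set T)
    (u : T -> 'rV[R]_n.+1) (v : T -> R) :
  {within A, continuous u} -> {within A, continuous v} ->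
  {within A, continuous (fun p => set_coord0 (u p) (v p))}.
Proof.
move=> cu cv; apply: within_mx => i j.
under [X in from_subspace _ X]eq_fun do rewrite mxE.
case: (j == ord0) => //.
apply: (within_comp (g := fun M : 'rV[R]_n.+1 => M ord0 j) cu).
  exact: (continuous_subspaceT (A := setT) (@coord_continuous _ _ _ _ _)).
by [].
Qed.

Lemma cont_snd_coord n i : continuous (fun p : R * 'rV[R]_n => p.2 ord0 i).
Proof.
exact: (cont_comp (@cont_snd R 'rV[R]_n) (@coord_continuous _ _ _ ord0 i)).
Qed.

Lemma closed_unit_cube n : closed (@unit_cube n).
Proof.
have -> : @unit_cube n = \bigcap_(i in [set: 'I_n])
    ((fun x : 'rV[R]_n => x ord0 i) @^-1` [set y | 0 <= y] `&`
     (fun x : 'rV[R]_n => x ord0 i) @^-1` [set y | y <= 1]).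
  apply/seteqP; split=> x.
    by move=> cx i _; have /andP[] := cx i.
  by move=> cx i; have [/= -> ->] := cx i I.
apply: closed_bigI => i _; apply: closedI.
  by apply: (preimage_closed _ (@closed_ge R 0)) => x _; exact: coord_continuous.
by apply: (preimage_closed _ (@closed_le R 1)) => x _; exact: coord_continuous.
Qed.

Definition cylinder (n : nat) : set (R * 'rV[R]_n) :=
  `[0, 1]%classic `*` @unit_cube n.

Lemma in_cylinder n t (x : 'rV[R]_n) :
  cylinder (t, x) <-> 0 <= t <= 1 /\ unit_cube x.
Proof. by rewrite /cylinder /setX /= in_itv. Qed.

Lemma closed_cylinder n : closed (@cylinder n).
Proof.
have -> : @cylinder n =
    fst @^-1` `[(0 : R), 1]%classic `&` snd @^-1` @unit_cube n by [].
apply: closedI.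
  by apply: (preimage_closed _ (@itv_closed _ R 0 1)) => x _; exact: cvg_fst.
by apply: (preimage_closed _ (@closed_unit_cube n)) => x _; exact: cvg_snd.
Qed.

End Cube.
Arguments unit_cube {R n}.
Arguments cube_boundary {R n}.
Arguments cylinder {R n}.

(* The total function [nloop_fun] is an arbitrary extension of a map I^n -> X:
   only its values on the cube matter, and two extensions of the same map are
   homotopic (homotopic_eq).
   The dimension is written n.-1.+1, as in {'GL_n[R]}, so that a first
   coordinate exists for every n; this is n for n > 0 (and 1 for n = 0). *)
Record nloop (R : realType) (X : topologicalType) (n : nat) (x0 : X) := NLoop {
  nloop_fun :> 'rV[R]_n.-1.+1 -> X;
  nloop_continuous : {within unit_cube, continuous nloop_fun};
  nloop_boundary : forall x, cube_boundary x -> nloop_fun x = x0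
}.
Arguments nloop R {X} n x0.
Arguments nloop_continuous {R X n x0} _ _ _ _.
Arguments nloop_boundary {R X n x0} _ _ _.

HB.instance Definition _ (R : realType) (X : topologicalType) n (x0 : X) :=
  gen_eqMixin (nloop R n x0).
HB.instance Definition _ (R : realType) (X : topologicalType) n (x0 : X) :=
  gen_choiceMixin (nloop R n x0).

Section Homotopy.
Variables (R : realType) (X : topologicalType) (n : nat) (x0 : X).
Implicit Types a b c : nloop R n x0.

(* homotopy relative to the boundary of the cube *)
Definition homotopic a b : Prop :=
  exists H : R -> 'rV[R]_n.-1.+1 -> X,
  [/\ {within cylinder,
        continuous (fun p : R * 'rV[R]_n.-1.+1 => H p.1 p.2)},
      forall x, unit_cube x -> H 0 x = a x,
      forall x, unit_cube x -> H 1 x = b x &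
      forall t x, 0 <= t <= 1 -> cube_boundary x -> H t x = x0].

Lemma within_snd (f : 'rV[R]_n.-1.+1 -> X) : {within unit_cube, continuous f} ->
  {within cylinder,
    continuous (fun p : R * 'rV[R]_n.-1.+1 => f p.2)}.
Proof.
move=> cf; apply: (within_comp (f := snd) _ cf); last by move=> p [].
by apply: continuous_subspaceT; exact: cont_snd.
Qed.

Lemma homotopic_eq a b : {in unit_cube, a =1 b} -> homotopic a b.
Proof.
move=> ab; exists (fun _ => a); split => //.
- exact: within_snd (nloop_continuous a).
- by move=> x cx; apply: ab; rewrite inE.
- by move=> t x _; exact: nloop_boundary.
Qed.

Lemma homotopic_refl a : homotopic a a.
Proof. exact: homotopic_eq. Qed.

Lemma homotopic_sym a b : homotopic a b -> homotopic b a.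
Proof.
move=> [H [cH H0 H1 Hb]]; exists (fun t => H (1 - t)); split.
- apply: (within_comp (f := fun p : R * 'rV[R]_n.-1.+1 => (1 - p.1, p.2)) _ cH).
    apply: continuous_subspaceT; apply: cont_pair; last exact: cont_snd.
    by apply: cont_sub; [exact: cont_cst|exact: cont_fst].
  move=> [t x] /in_cylinder [ct cx]; apply/in_cylinder.
  by split=> //=; lra.
- by move=> x cx; rewrite subr0 H1.
- by move=> x cx; rewrite subrr H0.
- by move=> t x ct bx; apply: Hb => //; lra.
Qed.

Lemma homotopic_trans a b c : homotopic a b -> homotopic b c -> homotopic a c.
Proof.
move=> [H [cH H0 H1 Hb]] [K [cK K0 K1 Kb]].
exists (fun t x => if t <= 2^-1 then H (2 * t) x else K (2 * t - 1) x); split.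
- apply: (within_if (c := fst) (r := 2^-1)
    (f := fun p => H (2 * p.1) p.2) (g := fun p => K (2 * p.1 - 1) p.2)).
  + exact: closed_cylinder.
  + exact: cont_fst.
  + apply: (within_comp (f := fun p : R * 'rV[R]_n.-1.+1 => (2 * p.1, p.2)) _ cH).
      apply: continuous_subspaceT; apply: cont_pair; last exact: cont_snd.
      by apply: cont_mul; [exact: cont_cst|exact: cont_fst].
    move=> [t x] [/in_cylinder [ct cx] /= ht]; apply/in_cylinder.
    by split=> //=; lra.
  + apply: (within_comp (f := fun p : R * 'rV[R]_n.-1.+1 => (2 * p.1 - 1, p.2)) _ cK).
      apply: continuous_subspaceT; apply: cont_pair; last exact: cont_snd.
      apply: cont_sub; last exact: cont_cst.
      by apply: cont_mul; [exact: cont_cst|exact: cont_fst].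
    move=> [t x] [/in_cylinder [ct cx] /= ht]; apply/in_cylinder.
    by split=> //=; lra.
  + move=> [t x] /in_cylinder [_ cx] /= ->; rewrite mulfV ?pnatr_eq0 // subrr.
    by rewrite H1 // K0.
- by move=> x cx; rewrite ifT ?mulr0 ?H0 //; lra.
- move=> x cx; rewrite ifF; last by apply/negbTE; lra.
  by rewrite (_ : 2 * 1 - 1 = 1) ?K1 //; lra.
- move=> t x ct bx; case: ifPn => ht; first by apply: Hb => //; lra.
  by apply: Kb => //; lra.
Qed.

Lemma cst_boundary (x : 'rV[R]_n.-1.+1) : cube_boundary x -> (fun=> x0) x = x0.
Proof. by []. Qed.

Definition cst_nloop : nloop R n x0 :=
  NLoop (continuous_subspaceT (@cst_continuous _ _ x0)) cst_boundary.

Definition homotopicb : rel (nloop R n x0) := fun a b => `[< homotopic a b >].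

Lemma homotopicb_refl : reflexive homotopicb.
Proof. by move=> a; apply/asboolP; exact: homotopic_refl. Qed.

Lemma homotopicb_sym : symmetric homotopicb.
Proof. by move=> a b; apply/asboolP/asboolP; exact: homotopic_sym. Qed.

Lemma homotopicb_trans : transitive homotopicb.
Proof.
by move=> b a c /asboolP ab /asboolP bc; apply/asboolP; exact: homotopic_trans bc.
Qed.

Canonical homotopic_equiv :=
  EquivRel homotopicb homotopicb_refl homotopicb_sym homotopicb_trans.

Definition homotopy_group : Type := {eq_quot homotopicb}.

HB.instance Definition _ := EqQuotient.on homotopy_group.
HB.instance Definition _ := Choice.on homotopy_group.

Definition hclass (a : nloop R n x0) : homotopy_group := \pi a.

Lemma hclassP a b : hclass a = hclass b <-> homotopic a b.
Proof.
split=> [/eqP|ab]; first by rewrite eqmodE => /asboolP.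
by apply/eqP; rewrite eqmodE; apply/asboolP.
Qed.

Lemma hclass_repr (c : homotopy_group) : hclass (repr c) = c.
Proof. exact: reprK. Qed.

Lemma hclassW (P : homotopy_group -> Prop) :
  (forall a, P (hclass a)) -> forall g, P g.
Proof. by move=> PP g; rewrite -(hclass_repr g). Qed.

End Homotopy.
Arguments homotopy_group R {X} n x0.

Section GroupLaw.
Variables (R : realType) (X : topologicalType) (n : nat) (x0 : X).
Local Notation N := n.-1.+1.
Implicit Types a b c : nloop R n x0.

Definition cat_fun (f g : 'rV[R]_N -> X) (x : 'rV[R]_N) : X :=
  if x ord0 ord0 <= 2^-1 then f (set_coord0 x (2 * x ord0 ord0))
  else g (set_coord0 x (2 * x ord0 ord0 - 1)).

Lemma within_cat (H K : R -> 'rV[R]_N -> X) :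
  {within cylinder,
    continuous (fun p : R * 'rV[R]_N => H p.1 p.2)} ->
  {within cylinder,
    continuous (fun p : R * 'rV[R]_N => K p.1 p.2)} ->
  (forall t x, 0 <= t <= 1 -> cube_boundary x -> H t x = x0) ->
  (forall t x, 0 <= t <= 1 -> cube_boundary x -> K t x = x0) ->
  {within cylinder,
    continuous (fun p : R * 'rV[R]_N => cat_fun (H p.1) (K p.1) p.2)}.
Proof.
move=> cH cK Hb Kb.
have c0 : continuous (fun p : R * 'rV[R]_N => p.2 ord0 ord0).
  exact: cont_snd_coord.
have cset A (f : R -> R) : continuous f -> {within A,
    continuous (fun p : R * 'rV[R]_N => (p.1, set_coord0 p.2 (f (p.2 ord0 ord0))))}.
  move=> cf; apply: within_pair.
    by apply: continuous_subspaceT; exact: cont_fst.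
  apply: within_set_coord0.
    by apply: continuous_subspaceT; exact: cont_snd.
  by apply: continuous_subspaceT; exact: (cont_comp c0 cf).
rewrite /cat_fun.
apply: (within_if (c := fun p : R * 'rV[R]_N => p.2 ord0 ord0) (r := 2^-1)
  (f := fun p => H p.1 (set_coord0 p.2 (2 * p.2 ord0 ord0)))
  (g := fun p => K p.1 (set_coord0 p.2 (2 * p.2 ord0 ord0 - 1)))) => //.
- exact: closed_cylinder.
- apply: (within_comp (f := fun p : R * 'rV[R]_N =>
    (p.1, set_coord0 p.2 (2 * p.2 ord0 ord0))) _ cH); first apply: (cset _ (fun t => 2 * t)).
    by apply: cont_mul; [exact: cont_cst|exact: cont_id].
  move=> [t x] [/in_cylinder [ct cx] /= x2]; apply/in_cylinder; split => //=; apply: cube_set_coord0 => //.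
  by have /= := cx ord0; lra.
- apply: (within_comp (f := fun p : R * 'rV[R]_N =>
    (p.1, set_coord0 p.2 (2 * p.2 ord0 ord0 - 1))) _ cK); first apply: (cset _ (fun t => 2 * t - 1)).
    apply: cont_sub; last exact: cont_cst.
    by apply: cont_mul; [exact: cont_cst|exact: cont_id].
  move=> [t x] [/in_cylinder [ct cx] /= x2]; apply/in_cylinder; split => //=; apply: cube_set_coord0 => //.
  by have /= := cx ord0; lra.
- move=> [t x] /in_cylinder [ct cx] /= ->.
  rewrite Hb ?Kb //; apply: boundary_set_coord0 => //; [left|right]; lra.
Qed.

Lemma cat_boundary (f g : 'rV[R]_N -> X) :
  (forall x, cube_boundary x -> f x = x0) ->
  (forall x, cube_boundary x -> g x = x0) ->
  forall x, cube_boundary x -> cat_fun f g x = x0.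
Proof.
move=> fb gb x bx; rewrite /cat_fun; have cx := bx.1.
have /= c0 := cx ord0.
case: (boundary_coord0P bx) => [x01|bt]; case: ifPn => hx.
- apply: fb; apply: boundary_set_coord0 => //; left.
  by case: x01 hx => ->; lra.
- apply: gb; apply: boundary_set_coord0 => //; right.
  by case: x01 hx => ->; lra.
- by apply: fb; apply: bt; lra.
- by apply: gb; apply: bt; lra.
Qed.

Lemma cat_continuous a b : {within unit_cube, continuous (cat_fun a b)}.
Proof.
have ca := within_snd (nloop_continuous a).
have cb := within_snd (nloop_continuous b).
have := @within_cat (fun=> a) (fun=> b) ca cb
  (fun t x _ => nloop_boundary a x)
  (fun t x _ => nloop_boundary b x).
move=> cab; apply: (within_comp (f := fun x => (0, x)) _ cab).
  apply: continuous_subspaceT.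
  by apply: cont_pair; [exact: cont_cst|exact: cont_id].
by move=> x cx; apply/in_cylinder; rewrite lexx ler01.
Qed.

Definition cat_nloop a b : nloop R n x0 :=
  NLoop (@cat_continuous a b)
        (cat_boundary (nloop_boundary a) (nloop_boundary b)).

Lemma cat_homotopic a a' b b' : homotopic a a' -> homotopic b b' ->
  homotopic (cat_nloop a b) (cat_nloop a' b').
Proof.
move=> [H [cH H0 H1 Hb]] [K [cK K0 K1 Kb]].
exists (fun t => cat_fun (H t) (K t)); split.
- exact: within_cat.
- move=> x cx; have /= c0 := cx ord0; rewrite /= /cat_fun.
  by case: ifPn => hx; [apply: H0|apply: K0]; apply: cube_set_coord0 => //; lra.
- move=> x cx; have /= c0 := cx ord0; rewrite /= /cat_fun.
  by case: ifPn => hx; [apply: H1|apply: K1]; apply: cube_set_coord0 => //; lra.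
- move=> t x ct; apply: cat_boundary => y; [exact: Hb|exact: Kb].
Qed.

Definition rev_fun (f : 'rV[R]_N -> X) (x : 'rV[R]_N) : X :=
  f (set_coord0 x (1 - x ord0 ord0)).

Lemma rev_continuous a : {within unit_cube, continuous (rev_fun a)}.
Proof.
apply: (within_comp (f := fun x => set_coord0 x (1 - x ord0 ord0)) _
                    (nloop_continuous a)).
  apply: within_set_coord0; first exact: (continuous_subspaceT (@cont_id _)).
  apply: continuous_subspaceT; apply: cont_sub; first exact: cont_cst.
  exact: coord_continuous.
by move=> x cx; apply: cube_set_coord0 => //; have /= := cx ord0; lra.
Qed.

Lemma rev_boundary a x : cube_boundary x -> rev_fun a x = x0.
Proof.
move=> bx; apply: nloop_boundary; have /= c0 := bx.1 ord0.
case: (boundary_coord0P bx) => [x01|]; last by apply; lra.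
apply: boundary_set_coord0; first exact: bx.1.
by case: x01 => ->; [right|left]; lra.
Qed.

Definition rev_nloop a : nloop R n x0 :=
  NLoop (@rev_continuous a) (@rev_boundary a).

Lemma reparam_homotopic a b c (u v : R -> R) :
  continuous u -> continuous v ->
  (forall t, 0 <= t <= 1 -> 0 <= u t <= 1) ->
  (forall t, 0 <= t <= 1 -> 0 <= v t <= 1) ->
  u 0 = v 0 -> u 1 = v 1 -> u 0 = 0 \/ u 0 = 1 -> u 1 = 0 \/ u 1 = 1 ->
  (forall x, unit_cube x -> b x = a (set_coord0 x (u (x ord0 ord0)))) ->
  (forall x, unit_cube x -> c x = a (set_coord0 x (v (x ord0 ord0)))) ->
  homotopic b c.
Proof.
move=> cu cv uI vI uv0 uv1 u0 u1 ub vc.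
pose w t s := (1 - t) * u s + t * v s.
have wI t s : 0 <= t <= 1 -> 0 <= s <= 1 -> 0 <= w t s <= 1.
  by move=> ct cs; have := uI _ cs; have := vI _ cs; rewrite /w; nra.
exists (fun t x => a (set_coord0 x (w t (x ord0 ord0)))); split.
- apply: (within_comp
    (f := fun p : R * 'rV[R]_N => set_coord0 p.2 (w p.1 (p.2 ord0 ord0)))
    _ (nloop_continuous a)).
    apply: within_set_coord0.
      by apply: continuous_subspaceT; exact: cont_snd.
    have c0 : continuous (fun p : R * 'rV[R]_N => p.2 ord0 ord0).
      exact: cont_snd_coord.
    apply: continuous_subspaceT; apply: cont_add; apply: cont_mul.
    + by apply: cont_sub; [exact: cont_cst|exact: cont_fst].
    + exact: (cont_comp c0 cu).
    + exact: cont_fst.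
    + exact: (cont_comp c0 cv).
  move=> [t x] /in_cylinder [ct cx].
  by apply: cube_set_coord0 => //; apply: wI => //; exact: cx.
- by move=> x cx; rewrite ub // /w subr0 mul1r mul0r addr0.
- by move=> x cx; rewrite vc // /w subrr mul0r mul1r add0r.
- move=> t x ct bx; apply: nloop_boundary; have c0 := bx.1 ord0.
  case: (boundary_coord0P bx) => [x01|]; last by apply; exact: wI.
  apply: boundary_set_coord0; first exact: bx.1.
  have wu s : u s = v s -> w t s = u s by rewrite /w => <-; lra.
  by case: x01 => ->; rewrite wu.
Qed.

Let caff (r s : R) : continuous (fun t : R => r * t + s).
Proof.
apply: cont_add; last exact: cont_cst.
by apply: cont_mul; [exact: cont_cst|exact: cont_id].
Qed.

Lemma cat_assoc a b c : homotopic (cat_nloop a (cat_nloop b c))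
                                  (cat_nloop (cat_nloop a b) c).
Proof.
apply: homotopic_sym.
pose u t : R := Num.min (2 * t + 0) (Num.min (1 * t + 4^-1) (2^-1 * t + 2^-1)).
have uP t : [\/ t <= 4^-1 /\ u t = 2 * t, 4^-1 <= t <= 2^-1 /\ u t = t + 4^-1
    | 2^-1 <= t /\ u t = 2^-1 * t + 2^-1].
  have h2 : Num.min (1 * t + 4^-1) (2^-1 * t + 2^-1) =
      if t <= 2^-1 then t + 4^-1 else 2^-1 * t + 2^-1.
    by rewrite /Num.min; do ![case: ifPn => ?]; lra.
  rewrite /u h2; case: (leP t 2^-1) => ?; rewrite /Num.min; case: ifPn => ?.
  - by apply: Or31; split; lra.
  - by apply: Or32; split; lra.
  - by exfalso; lra.
  - by apply: Or33; split; lra.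
apply: (@reparam_homotopic (cat_nloop a (cat_nloop b c)) _ _ u id).
- by apply: cont_min => //; apply: cont_min.
- exact: cont_id.
- by move=> t ct; case: (uP t) => -[? ->]; lra.
- by [].
- by case: (uP 0) => -[? ->]; lra.
- by case: (uP 1) => -[? ->]; lra.
- by left; case: (uP 0) => -[? ->]; lra.
- by right; case: (uP 1) => -[? ->]; lra.
- move=> x cx; have /= c0 := cx ord0.
  rewrite /= /cat_fun /= /cat_fun !set_coord00 !set_coord0_set.
  set t := x ord0 ord0 in c0 *.
  have [t4|t4] := leP t 4^-1.
    have -> : u t = 2 * t by case: (uP t) => -[? ->]; lra.
    by rewrite !ifT //; lra.
  have [t2|t2] := leP t 2^-1.
    have -> : u t = t + 4^-1 by case: (uP t) => -[? ->]; lra.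
    rewrite ifF; last by apply/negbTE; lra.
    rewrite ifF; last by apply/negbTE; lra.
    rewrite ifT; last lra.
    by congr (nloop_fun _ (set_coord0 _ _)); lra.
  have -> : u t = 2^-1 * t + 2^-1 by case: (uP t) => -[? ->]; lra.
  rewrite ifF; last by apply/negbTE; lra.
  rewrite ifF; last by apply/negbTE; lra.
  by congr (nloop_fun _ (set_coord0 _ _)); lra.
- by move=> x cx; rewrite set_coord0_id.
Qed.

Lemma cat_cstl a : homotopic (cat_nloop (cst_nloop R n x0) a) a.
Proof.
apply: (@reparam_homotopic a _ _ (fun t => Num.max 0 (2 * t + -1)) id).
- by apply: cont_max; [exact: cont_cst|].
- exact: cont_id.
- by move=> t ct; rewrite /Num.max; case: ifPn => ?; lra.
- by [].
- by rewrite /Num.max; case: ifPn => ?; lra.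
- by rewrite /Num.max; case: ifPn => ?; lra.
- by left; rewrite /Num.max; case: ifPn => ?; lra.
- by right; rewrite /Num.max; case: ifPn => ?; lra.
- move=> x cx; have /= c0 := cx ord0; rewrite /= /cat_fun.
  set t := x ord0 ord0 in c0 *.
  rewrite /Num.max; do ![case: ifPn => ?]; try (exfalso; lra).
  + by rewrite nloop_boundary //; apply: boundary_set_coord0 => //; left.
  + by [].
- by move=> x cx; rewrite set_coord0_id.
Qed.

Lemma cat_cstr a : homotopic (cat_nloop a (cst_nloop R n x0)) a.
Proof.
apply: (@reparam_homotopic a _ _ (fun t => Num.min 1 (2 * t + 0)) id).
- by apply: cont_min; [exact: cont_cst|].
- exact: cont_id.
- by move=> t ct; rewrite /Num.min; case: ifPn => ?; lra.
- by [].
- by rewrite /Num.min; case: ifPn => ?; lra.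
- by rewrite /Num.min; case: ifPn => ?; lra.
- by left; rewrite /Num.min; case: ifPn => ?; lra.
- by right; rewrite /Num.min; case: ifPn => ?; lra.
- move=> x cx; have /= c0 := cx ord0; rewrite /= /cat_fun.
  set t := x ord0 ord0 in c0 *; rewrite addr0.
  rewrite /Num.min; do ![case: ifPn => ?]; try (exfalso; lra); try by [].
  + by rewrite nloop_boundary //; apply: boundary_set_coord0 => //; right.
- by move=> x cx; rewrite set_coord0_id.
Qed.

Lemma cat_revl a : homotopic (cat_nloop (rev_nloop a) a) (cst_nloop R n x0).
Proof.
apply: (@reparam_homotopic a _ _
  (fun t => Num.max (-2 * t + 1) (2 * t + -1)) (fun=> 1)).
- exact: cont_max.
- exact: cont_cst.
- by move=> t ct; rewrite /Num.max; case: ifPn => ?; lra.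
- by move=> t ct; lra.
- by rewrite /Num.max; case: ifPn => ?; lra.
- by rewrite /Num.max; case: ifPn => ?; lra.
- by right; rewrite /Num.max; case: ifPn => ?; lra.
- by right; rewrite /Num.max; case: ifPn => ?; lra.
- move=> x cx; have /= c0 := cx ord0.
  rewrite /= /cat_fun /rev_fun !set_coord00 !set_coord0_set.
  set t := x ord0 ord0 in c0 *.
  by rewrite /Num.max; do ![case: ifPn => ?]; first
    [congr (nloop_fun _ (set_coord0 _ _)); lra | exfalso; lra].
- by move=> x cx; rewrite /= nloop_boundary //; apply: boundary_set_coord0 => //; right.
Qed.

Lemma cat_revr a : homotopic (cat_nloop a (rev_nloop a)) (cst_nloop R n x0).
Proof.
apply: (@reparam_homotopic a _ _
  (fun t => Num.min (2 * t + 0) (-2 * t + 2)) (fun=> 0)).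
- exact: cont_min.
- exact: cont_cst.
- by move=> t ct; rewrite /Num.min; case: ifPn => ?; lra.
- by move=> t ct; lra.
- by rewrite /Num.min; case: ifPn => ?; lra.
- by rewrite /Num.min; case: ifPn => ?; lra.
- by left; rewrite /Num.min; case: ifPn => ?; lra.
- by left; rewrite /Num.min; case: ifPn => ?; lra.
- move=> x cx; have /= c0 := cx ord0.
  rewrite /= /cat_fun /rev_fun !set_coord00 !set_coord0_set.
  set t := x ord0 ord0 in c0 *.
  by rewrite /Num.min; do ![case: ifPn => ?]; first
    [congr (nloop_fun _ (set_coord0 _ _)); lra | exfalso; lra].
- by move=> x cx; rewrite /= nloop_boundary //; apply: boundary_set_coord0 => //; left.
Qed.

Local Notation pi_n := (homotopy_group R n x0).

Definition hg_one : pi_n := hclass (cst_nloop R n x0).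
Definition hg_inv (g : pi_n) : pi_n := hclass (rev_nloop (repr g)).
Definition hg_mul (g h : pi_n) : pi_n := hclass (cat_nloop (repr g) (repr h)).

Lemma hg_mul_class a b : hg_mul (hclass a) (hclass b) = hclass (cat_nloop a b).
Proof. by apply/hclassP/cat_homotopic; apply/hclassP; rewrite hclass_repr. Qed.

Lemma hg_mulA : associative hg_mul.
Proof.
elim/hclassW=> a; elim/hclassW=> b; elim/hclassW=> c.
by rewrite !hg_mul_class; apply/hclassP; exact: cat_assoc.
Qed.

Lemma hg_mul1 : left_id hg_one hg_mul.
Proof. by elim/hclassW=> a; rewrite hg_mul_class; apply/hclassP; exact: cat_cstl. Qed.

Lemma hg_mulr1 : right_id hg_one hg_mul.
Proof. by elim/hclassW=> a; rewrite hg_mul_class; apply/hclassP; exact: cat_cstr. Qed.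

Lemma hg_mulV : left_inverse hg_one hg_inv hg_mul.
Proof.
move=> g; rewrite -[X in hg_mul _ X]hclass_repr hg_mul_class.
by apply/hclassP; exact: cat_revl.
Qed.

Lemma hg_mulrV : right_inverse hg_one hg_inv hg_mul.
Proof.
move=> g; rewrite -[X in hg_mul X _]hclass_repr hg_mul_class.
by apply/hclassP; exact: cat_revr.
Qed.

HB.instance Definition _ := isGroup.Build pi_n
  hg_mulA hg_mul1 hg_mulr1 hg_mulV hg_mulrV.

Lemma hclassM a b : (hclass a * hclass b)%g = hclass (cat_nloop a b).
Proof. exact: hg_mul_class. Qed.

Lemma hclass1 : hclass (cst_nloop R n x0) = 1%g.
Proof. by []. Qed.

Lemma hclassV a : ((hclass a)^-1)%g = hclass (rev_nloop a).
Proof.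
have h : (hclass (rev_nloop a) * hclass a)%g = 1%g.
  by rewrite hclassM; apply/hclassP; exact: cat_revl.
by rewrite -[LHS]mul1g -h -mulgA mulgV mulg1.
Qed.

End GroupLaw.

Section SubgroupTopology.
Variable G : groupType.

Record subgroup := Subgroup {
  subgroup_set :> set G;
  subgroupP : group_closed (mem subgroup_set)
}.

Lemma subgroup1 (H : subgroup) : subgroup_set H 1%g.
Proof. by have [/set_mem] := subgroupP H. Qed.

Lemma subgroup_div (H : subgroup) g h :
  subgroup_set H g -> subgroup_set H h -> subgroup_set H (g / h)%g.
Proof.
by have [_ HB] := subgroupP H => Hg Hh; apply/set_mem/HB; apply/mem_set.
Qed.

Lemma subgroupV (H : subgroup) g :
  subgroup_set H g -> subgroup_set H (g^-1)%g.
Proof. by move=> Hg; rewrite -div1g; exact: subgroup_div (subgroup1 H) Hg. Qed.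

Lemma subgroupM (H : subgroup) g h :
  subgroup_set H g -> subgroup_set H h -> subgroup_set H (g * h)%g.
Proof. by move=> Hg /subgroupV Hh; rewrite -[h]invgK; exact: subgroup_div. Qed.

Lemma group_closed_set (H : set G) :
  H 1%g -> (forall g h, H g -> H h -> H (g * h)%g) ->
  (forall g, H g -> H (g^-1)%g) -> group_closed (mem H).
Proof.
move=> H1 HM HV; split; first exact/mem_set.
by move=> g h /set_mem Hg /set_mem Hh; apply/mem_set/HM => //; exact: HV.
Qed.

Definition lcoset (g : G) (H : subgroup) : set G := [set (g * h)%g | h in H].

Lemma lcoset_id g (H : subgroup) : lcoset g H g.
Proof. by exists 1%g; [exact: subgroup1|rewrite mulg1]. Qed.

Lemma lcoset_sub g h (H K : subgroup) :
  K `<=` H -> lcoset g H h -> lcoset h K `<=` lcoset g H.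
Proof.
move=> KH [k Hk <-] _ [l Kl <-]; exists (k * l)%g; last by rewrite mulgA.
by apply: subgroupM => //; exact: KH.
Qed.

Record nbhd_family := NbhdFamily {
  nbhd_members :> set subgroup;
  nbhd_nonempty : nbhd_members !=set0;
  nbhd_directed : forall H K, nbhd_members H -> nbhd_members K ->
    exists2 S, nbhd_members S & S `<=` H `&` K
}.

(* G with the topology whose open sets are the unions of left cosets of members
   of F *)
Definition subgroup_topology (F : nbhd_family) : Type := G.

Section Base.
Variable F : nbhd_family.

Definition left_cosets : set (set G) :=
  [set B | exists g H, nbhd_members F H /\ B = lcoset g H].

HB.instance Definition _ := Choice.on (subgroup_topology F).

Let left_cosets_cover : \bigcup_(B in left_cosets) B = [set: subgroup_topology F].
Proof.
apply/seteqP; split=> // g _; have [H FH] := nbhd_nonempty F.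
by exists (lcoset g H); [exists g, H|exact: lcoset_id].
Qed.

Let left_cosets_join (A B : set G) (g : subgroup_topology F) :
  left_cosets A -> left_cosets B -> A g -> B g ->
  exists C, [/\ left_cosets C, C g & C `<=` A `&` B].
Proof.
move=> [a [H [FH ->]]] [b [K [FK ->]]] Ag Bg.
have [S FS] := nbhd_directed FH FK; rewrite subsetI => -[SH SK].
exists (lcoset g S); split; [by exists g, S|exact: lcoset_id|].
by rewrite subsetI; split; exact: lcoset_sub.
Qed.

HB.instance Definition _ := isBaseTopological.Build (subgroup_topology F)
  left_cosets_cover left_cosets_join.

End Base.

Lemma supergroups_nonempty (H : subgroup) :
  [set K : subgroup | H `<=` K] !=set0.
Proof. by exists H. Qed.

Lemma supergroups_directed (H K L : subgroup) : H `<=` K -> H `<=` L ->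
  exists2 S : subgroup, H `<=` S & S `<=` K `&` L.
Proof. by move=> HK HL; exists H => //; rewrite subsetI. Qed.

Definition supergroups (H : subgroup) : nbhd_family :=
  NbhdFamily (supergroups_nonempty H) (@supergroups_directed H).

End SubgroupTopology.

Section InducedMap.
Variables (R : realType) (X Y : topologicalType) (n : nat).
Variables (f : Y -> X) (y0 : Y) (x0 : X).
Hypotheses (cf : continuous f) (fy0 : f y0 = x0).

Lemma map_continuous (a : nloop R n y0) :
  {within unit_cube, continuous (f \o a)}.
Proof.
exact: (within_comp (B := setT) (nloop_continuous a) (continuous_subspaceT cf)).
Qed.

Lemma map_boundary (a : nloop R n y0) x : cube_boundary x -> (f \o a) x = x0.
Proof. by move=> bx; rewrite /= nloop_boundary. Qed.

Definition map_nloop (a : nloop R n y0) : nloop R n x0 :=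
  NLoop (@map_continuous a) (@map_boundary a).

Definition pi_map (g : homotopy_group R n y0) : homotopy_group R n x0 :=
  hclass (map_nloop (repr g)).

Lemma map_homotopic a b :
  homotopic a b -> homotopic (map_nloop a) (map_nloop b).
Proof.
move=> [H [cH H0 H1 Hb]]; exists (fun t x => f (H t x)); split.
- exact: (within_comp (B := setT) cH (continuous_subspaceT cf)).
- by move=> x cx; rewrite H0.
- by move=> x cx; rewrite H1.
- by move=> t x ct bx; rewrite Hb.
Qed.

Lemma pi_map_class a : pi_map (hclass a) = hclass (map_nloop a).
Proof. by apply/hclassP/map_homotopic/hclassP; rewrite hclass_repr. Qed.

End InducedMap.

Section InducedMorphism.
Variables (R : realType) (X Y : topologicalType) (n : nat).
Variables (f : Y -> X) (y0 : Y) (x0 : X).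
Hypotheses (cf : continuous f) (fy0 : f y0 = x0).

Lemma pi_map_monoid_morphism :
  monoid.monoid_morphism (@pi_map R X Y n f y0 x0 cf fy0).
Proof.
split=> [|g h].
  rewrite -hclass1 pi_map_class; apply/hclassP/homotopic_eq => x _ /=.
  exact: fy0.
elim/hclassW: g => a; elim/hclassW: h => b.
rewrite hclassM !pi_map_class hclassM; apply/hclassP/homotopic_eq => x _ /=.
by rewrite /cat_fun; case: ifP.
Qed.

HB.instance Definition _ := isUMagmaMorphism.Build _ _
  (@pi_map R X Y n f y0 x0 cf fy0) pi_map_monoid_morphism.

End InducedMorphism.

Definition open_sets (T : topologicalType) : set (set T) := open.
Arguments open_sets : clear implicits.

Section SmallLoops.
Variables (R : realType) (X : topologicalType) (n : nat) (x0 : X).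
Local Notation pi_n := (homotopy_group R n x0).

Definition small_nloop (a : nloop R n x0) : Prop :=
  forall U : set X, open U -> U x0 ->
  exists2 f : nloop R n x0, f @` unit_cube `<=` U & hclass a = hclass f.

Definition small_classes : set pi_n := [set hclass a | a in small_nloop].

Lemma small_classes_closed : group_closed (mem small_classes).
Proof.
apply: group_closed_set.
- exists (cst_nloop R n x0); last exact: hclass1.
  by move=> U oU Ux0; exists (cst_nloop R n x0) => // _ [x _ <-].
- move=> _ _ [a sa <-] [b sb <-]; exists (cat_nloop a b); last by rewrite hclassM.
  move=> U oU Ux0; have [f fU af] := sa U oU Ux0; have [g gU bg] := sb U oU Ux0.
  exists (cat_nloop f g); last by rewrite -!hclassM af bg.
  move=> _ [x cx <-] /=; have /= c0 := cx ord0; rewrite /cat_fun.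
  case: ifPn => hx; [apply: fU|apply: gU];
    by apply: imageP; apply: cube_set_coord0 => //; lra.
- move=> _ [a sa <-]; exists (rev_nloop a); last by rewrite hclassV.
  move=> U oU Ux0; have [f fU af] := sa U oU Ux0.
  exists (rev_nloop f); last by rewrite -!hclassV af.
  move=> _ [x cx <-] /=; have /= c0 := cx ord0.
  by apply: fU; apply: imageP; apply: cube_set_coord0 => //; lra.
Qed.

Definition small_subgroup : subgroup pi_n := Subgroup small_classes_closed.

Definition basepoint (U : set X) (Ux0 : U x0) : U := SigSub (mem_set Ux0).

Lemma inclusion_basepoint (U : set X) (Ux0 : U x0) :
  set_val (basepoint Ux0) = x0.
Proof. by []. Qed.

(* U carries the initial topology of its inclusion [set_val] into X. *)
Definition pi_incl (U : set X) (Ux0 : U x0) :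
    homotopy_group R n (basepoint Ux0) -> pi_n :=
  pi_map (@initial_continuous U X set_val) (inclusion_basepoint Ux0).

Arguments pi_incl {U} Ux0 _.

Lemma incl_image_closed (U : set X) (Ux0 : U x0) :
  group_closed (mem (range (pi_incl Ux0))).
Proof.
apply: group_closed_set.
- by exists 1%g => //; exact: gmulf1.
- by move=> _ _ [g _ <-] [h _ <-]; exists (g * h)%g => //; exact: gmulfM.
- move=> _ [g _ <-]; exists (g^-1)%g => //.
  exact: gmulfV.
Qed.

Definition incl_image (U : set X) (Ux0 : U x0) : subgroup pi_n :=
  Subgroup (incl_image_closed Ux0).

Definition semilocally_connected (H : subgroup pi_n) : Prop :=
  exists (U : set X) (Ux0 : U x0), open U /\ incl_image Ux0 `<=` H.

Definition whisker_members : set (subgroup pi_n) :=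
  [set H | exists (U : set X) (Ux0 : U x0), open U /\ H = incl_image Ux0].

Lemma whisker_nonempty : whisker_members !=set0.
Proof. by exists (@incl_image setT I), setT, I; split=> //; exact: openT. Qed.

Lemma incl_image_sub (U V : set X) (Ux0 : U x0) (Vx0 : V x0) :
  U `<=` V -> incl_image Ux0 `<=` incl_image Vx0.
Proof.
move=> UV _ [g _ <-]; elim/hclassW: g => a.
pose j (u : U) : V := SigSub (mem_set (UV _ (set_valP u))).
have cj : continuous j.
  by apply/continuousP => _ [B oB <-]; exists B.
have j0 : j (basepoint Ux0) = basepoint Vx0 by exact: val_inj.
exists (hclass (map_nloop cj j0 a)) => //.
by rewrite /pi_incl !pi_map_class; apply/hclassP; exact: homotopic_eq.
Qed.

Lemma whisker_directed H K : whisker_members H -> whisker_members K ->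
  exists2 S, whisker_members S & S `<=` H `&` K.
Proof.
move=> [U [Ux0 [oU ->]]] [V [Vx0 [oV ->]]].
have UVx0 : (U `&` V) x0 by [].
exists (incl_image UVx0).
  by exists (U `&` V), UVx0; split=> //; exact: openI.
by rewrite subsetI; split; apply: incl_image_sub => x [].
Qed.

Definition whisker_family : nbhd_family pi_n :=
  NbhdFamily whisker_nonempty whisker_directed.

Definition whisker_topology : topologicalType := subgroup_topology whisker_family.

Definition supergroup_topology (H : subgroup pi_n) : topologicalType :=
  subgroup_topology (supergroups H).

End SmallLoops.
Arguments small_subgroup R {X} n x0.
Arguments semilocally_connected {R X n x0} H.
Arguments whisker_topology R {X} n x0.
Arguments supergroup_topology {R X n x0} H.

(* Main.v *)
(** The small subgroup is the intersection of the members of the whisker family: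
    a loop with values in [U] is the image of a loop of the subspace [U]. Inclusion of
    subgroup topologies means that each member of the coarser family contains one
    of the finer family, so everything reduces to comparing the sets
    [pi_n(i)(pi_n(U, x0))] with a single subgroup. *)
Require Import Defs.
From mathcomp Require Import all_boot all_order all_algebra.
From mathcomp Require Import all_classical all_reals.
From mathcomp Require Import topology normedtype.

Set Implicit Arguments.
Unset Strict Implicit.
Unset Printing Implicit Defensive.
Local Open Scope classical_set_scope.

Section SubgroupTopologyOrder.
Variable G : groupType.
Implicit Types (F : nbhd_family G) (H K : subgroup G).

Lemma lcoset1 H : lcoset 1%g H = H.
Proof.
by apply/seteqP; split=> [_ [h Hh <-]|h Hh]; [rewrite mul1g|exists h; rewrite ?mul1g].
Qed.

(** A basic coset [lcoset a H] that contains [g] also contains [lcoset g H], so basic neighbourhoods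
    can be centred at [g]. *)
Lemma open_subgroup_topologyP F (A : set (subgroup_topology F)) :
  open A <-> forall g, A g -> exists2 H, nbhd_members F H & lcoset g H `<=` A.
Proof.
rewrite openE /=; split=> [oA g Ag|hA g Ag].
  have [B [[D sD <-] [C DC Cg] BA]] := oA g Ag.
  have [a [H [FH CE]]] := sD _ DC.
  exists H => // h gh; apply: BA; exists C => //.
  by rewrite CE in Cg *; exact: lcoset_sub gh.
have [H FH HA] := hA g Ag.
exists (lcoset g H); split=> //; last exact: lcoset_id.
exists [set lcoset g H]; last by rewrite bigcup_set1.
by move=> _ ->; exists g, H.
Qed.

Lemma open_subgroup F H : nbhd_members F H -> open (H : set (subgroup_topology F)).
Proof.
move=> FH; apply/open_subgroup_topologyP => g Hg; exists H => // _ [h Hh <-].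
exact: subgroupM.
Qed.

(** A member [H] of [F] is open and contains 1, so openness for [F'] puts some [K] inside it;
    conversely, left translation carries [K] inside [H] to every point. *)
Lemma subgroup_topology_leP F F' :
  (open_sets (subgroup_topology F) : set (set G))
    `<=` open_sets (subgroup_topology F') <->
  forall H, nbhd_members F H -> exists2 K, nbhd_members F' K & K `<=` H.
Proof.
split=> [oFF' H /open_subgroup/oFF'/open_subgroup_topologyP|FF' A].
  by move=> /(_ _ (subgroup1 H)) [K F'K]; rewrite lcoset1; exists K.
move=> /open_subgroup_topologyP oA; apply/open_subgroup_topologyP => g Ag.
have [H FH HA] := oA g Ag; have [K F'K KH] := FF' H FH.
by exists K => // _ [k Kk <-]; apply: HA; exists k => //; exact: KH.
Qed.

End SubgroupTopologyOrder.

Section SmallSubgroup.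
Import numFieldNormedType.Exports.
Variables (R : realType) (X : topologicalType) (n : nat) (x0 : X).
Local Notation small := (small_subgroup R n x0).

Lemma incl_imageP (U : set X) (Ux0 : U x0) (g : homotopy_group R n x0) :
  subgroup_set (incl_image R n Ux0) g <->
  exists2 f : nloop R n x0, f @` unit_cube `<=` U & g = hclass f.
Proof.
split=> [[h _ <-]|[f fU ->]].
  elim/hclassW: h => b; rewrite /pi_incl pi_map_class.
  by eexists; last reflexivity; move=> _ [x _ <-]; exact: set_valP.
have fUx x (cx : unit_cube x) : U (f x) by exact: fU.
(* A loop is a total function, so the lift needs a value off the cube. *)
pose l x : U := if pselect (unit_cube x) is left cx
  then SigSub (mem_set (fUx x cx)) else basepoint Ux0.
have lE x : unit_cube x -> set_val (l x) = f x by rewrite /l; case: pselect.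
have cfl : {within unit_cube, continuous (set_val \o l)}.
  apply: (@subspace_eq_continuous _ _ _ f); last exact: nloop_continuous.
  by move=> x /set_mem/lE/esym.
(* [U] has the initial topology: its open sets are the preimages under [set_val] of open sets of
   [X], so continuity of [set_val \o l] suffices. *)
have cl : {within unit_cube, continuous l}.
  apply/continuousP => _ [B oB <-].
  by have /continuousP := cfl; apply.
have bl x : cube_boundary x -> l x = basepoint Ux0.
  by move=> bx; apply: val_inj; rewrite [LHS]lE ?nloop_boundary //; case: bx.
exists (hclass (NLoop cl bl)) => //; rewrite /pi_incl pi_map_class.
by apply/hclassP/homotopic_eq => x /set_mem cx; exact: lE.
Qed.

Lemma small_subgroupP (g : homotopy_group R n x0) :
  subgroup_set small g <-> forall (U : set X) (Ux0 : U x0), open U -> subgroup_set (incl_image R n Ux0) g.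
Proof.
split=> [[a sa <-] U Ux0 oU|hg].
  by apply/incl_imageP; exact: sa.
elim/hclassW: g hg => a ha; exists a => // U oU Ux0.
exact/incl_imageP/ha.
Qed.

Lemma small_sub_incl_image (U : set X) (Ux0 : U x0) :
  open U -> small `<=` incl_image R n Ux0.
Proof. by move=> oU g /small_subgroupP sg; exact: sg. Qed.

(** [K] is the least member of [supergroups K], so the inclusion says that [K] lies in every
    [incl_image], and these intersect in [small]. *)
Lemma whisker_le_supergroupP (K : subgroup (homotopy_group R n x0)) :
  (open_sets (whisker_topology R n x0) : set (set (homotopy_group R n x0)))
    `<=` open_sets (supergroup_topology K) <-> K `<=` small.
Proof.
split=> [/subgroup_topology_leP le g Kg|Ks].
  apply/small_subgroupP => U Ux0 oU.
  have [|L KL] := le (incl_image R n Ux0); first by exists U, Ux0.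
  by apply; exact: KL.
apply/subgroup_topology_leP => _ [U [Ux0 [oU ->]]]; exists K; first by move=> g.
by move=> g /Ks; exact: small_sub_incl_image.
Qed.

(** An [incl_image] inside the least member [K] of [supergroups K] lies inside all the others. *)
Lemma supergroup_le_whiskerP (K : subgroup (homotopy_group R n x0)) :
  (open_sets (supergroup_topology K) : set (set (homotopy_group R n x0)))
    `<=` open_sets (whisker_topology R n x0) <-> semilocally_connected K.
Proof.
split=> [/subgroup_topology_leP le|[U [Ux0 [oU UK]]]].
  have [//|_ [U [Ux0 [oU ->]]] UK] := le K.
  by exists U, Ux0.
apply/subgroup_topology_leP => L KL; exists (incl_image R n Ux0); last first.
  by move=> g /UK; exact: KL.
by exists U, Ux0.
Qed.

End SmallSubgroup.

Theorem corollary4p7 (R : realType) (X : topologicalType) (x0 : X) (n : nat)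
    (n_ge2 : (2 <= n)%N) :
  [/\ (open_sets (whisker_topology R n x0) : set (set (homotopy_group R n x0)))
        `<=` open_sets (supergroup_topology (small_subgroup R n x0)),
      semilocally_connected (small_subgroup R n x0) <->
        open_sets (whisker_topology R n x0) =
        open_sets (supergroup_topology (small_subgroup R n x0))
          :> set (set (homotopy_group R n x0)) &
      forall K : subgroup (homotopy_group R n x0),
        open_sets (whisker_topology R n x0) = open_sets (supergroup_topology K)
          :> set (set (homotopy_group R n x0)) ->
        K = small_subgroup R n x0 :> set (homotopy_group R n x0)].
Proof.
have le_small := (whisker_le_supergroupP (small_subgroup R n x0)).2 (fun _ => id).
split=> // [|K eqK].
  (* One inclusion is [le_small], so equality amounts to the reverse one. *)
  rewrite -supergroup_le_whiskerP; split=> [ge|->//].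
  exact/seteqP.
apply/seteqP; split.
  by apply/whisker_le_supergroupP; rewrite eqK.
(* The other half of the equality gives an [incl_image] inside [K], and every [incl_image] of an
   open set contains the small subgroup. *)
have [|U [Ux0 [oU UK]]] := (supergroup_le_whiskerP K).1; first by rewrite eqK.
by move=> g sg; apply: UK; exact: small_sub_incl_image.
Qed.
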